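(* Let $(D,\dashv,\vdash)$ be a rectangular doppelsemigroup. Then $(D,\dashv,\vdash)$ is strong if and only if it is trivial.
   Context: A doppelsemigroup $(D,\dashv,\vdash)$ is a set $D$ with two associative binary operations $\dashv,\vdash$ satisfying $(x\dashv y)\vdash z=x\dashv(y\vdash z)$ and $(x\vdash y)\dashv z=x\vdash(y\dashv z)$ for all $x,y,z\in D$. It is rectangular if $x\dashv y\dashv z=x\dashv z$ and $x\vdash y\vdash z=x\vdash z$ for all $x,y,z\in D$; strong if $x\dashv(y\vdash z)=x\vdash(y\dashv z)$ for all $x,y,z\in D$; trivial if the operations $\dashv$ and $\vdash$ coincide. *)

(* Defs.v *)
From mathcomp Require Import all_boot.

Set Implicit Arguments.
Unset Strict Implicit.
Unset Printing Implicit Defensive.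

Declare Scope doppel_scope.
Delimit Scope doppel_scope with doppel.

Reserved Notation "x ⊣ y" (at level 40, left associativity).
Reserved Notation "x ⊢ y" (at level 40, left associativity).

Record doppelsemigroup : Type := Doppelsemigroup {
  doppel_sort :> Type;
  dashv : doppel_sort -> doppel_sort -> doppel_sort;
  vdash : doppel_sort -> doppel_sort -> doppel_sort;
  dashvA : associative dashv;
  vdashA : associative vdash;
  dashv_vdashA : forall x y z, vdash (dashv x y) z = dashv x (vdash y z);
  vdash_dashvA : forall x y z, dashv (vdash x y) z = vdash x (dashv y z)
}.

Notation "x ⊣ y" := (dashv x y) : doppel_scope.
Notation "x ⊢ y" := (vdash x y) : doppel_scope.

Local Open Scope doppel_scope.

(* Neither operation is required to be idempotent. *)
Definition rectangular (D : doppelsemigroup) : Prop :=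
  (forall x y z : D, x ⊣ y ⊣ z = x ⊣ z) /\
  (forall x y z : D, x ⊢ y ⊢ z = x ⊢ z).

Definition strong (D : doppelsemigroup) : Prop :=
  forall x y z : D, x ⊣ (y ⊢ z) = x ⊢ (y ⊣ z).

Definition trivial_doppel (D : doppelsemigroup) : Prop :=
  forall x y : D, x ⊣ y = x ⊢ y.

(* Main.v *)
Require Import Defs.
From mathcomp Require Import all_boot.

(** In a rectangular doppelsemigroup an arbitrary middle factor may be inserted
    into a product.  Inserting the opposite product [y ⊢ y] into [x ⊣ z], and
    [y ⊣ y] into [x ⊢ z], creates a mixed word; the interchange laws and
    strongness then swap its two kinds of operations, after which rectangularity
    removes the repeated [y].  The results are [x ⊢ (y ⊣ z)] and
    [x ⊣ (y ⊢ z)], which strongness identifies, so the two operations agree. *)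

Local Open Scope doppel_scope.

(** The inserted middle factor is [y ⊢ y]: strongness exchanges the outer two
    operations of [x ⊣ (y ⊢ (y ⊣ z))], leaving [y ⊣ y ⊣ z] to collapse. *)
Lemma strong_dashv_mixed (D : doppelsemigroup) (x y z : D) :
  rectangular D -> strong D -> x ⊣ z = x ⊢ (y ⊣ z).
Proof.
move=> [rectL _] strongD.
by rewrite -(rectL x (y ⊢ y) z) -dashvA vdash_dashvA strongD dashvA rectL.
Qed.

(** The mirror image under exchange of the two operations, a symmetry of the
    axioms. *)
Lemma strong_vdash_mixed (D : doppelsemigroup) (x y z : D) :
  rectangular D -> strong D -> x ⊢ z = x ⊣ (y ⊢ z).
Proof.
move=> [_ rectR] strongD.
by rewrite -(rectR x (y ⊣ y) z) -vdashA dashv_vdashA -strongD vdashA rectR.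
Qed.

Theorem proposition4p2 (D : doppelsemigroup) (Drect : rectangular D) :
  strong D <-> trivial_doppel D.
Proof.
split=> [strongD x y | trivD x y z]; last by rewrite !trivD.
(* Any middle factor would do; x is merely one at hand. *)
rewrite (strong_dashv_mixed _ x x y Drect strongD).
by rewrite (strong_vdash_mixed _ x x y Drect strongD) strongD.
Qed.
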